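(* Fix $n\ge 2$ and set $u(x)=(1-|x|)^2$ for $x\in\overline{B_1}\subset\mathbb R^n$. Then $$u\in C(\overline{B_1})\cap C^\infty(B_1\setminus\{0\}),\qquad u\ge 0\ \text{in }B_1,\qquad u=0\ \text{on }\partial B_1,$$ and, in the viscosity sense, $$\Delta u\le 0\quad\text{in }\{x\in B_1:\ |\nabla u(x)|\ge 1\}.$$ Moreover, for every $\xi\in\partial B_1$, if $\nu$ denotes the inner unit normal to $\partial B_1$ at $\xi$, then $\partial_\nu u(\xi)=0$. Hence Hopf's boundary point conclusion (strict positivity of the inner normal derivative at a boundary zero) fails in this large-gradient regime.
   Context: $B_1$ is the open unit ball of $\mathbb R^n$ centered at $0$. Viscosity inequality in the large-gradient regime: for $u\in C(B_1)$ and $\gamma>0$, ''$\Delta u\le0$ in $\{x\in B_1:|\nabla u(x)|\ge\gamma\}$ in the viscosity sense'' means: for every $x_0\in B_1$ and every $\varphi\in C^2(B_1)$ such that $u-\varphi$ has a local minimum at $x_0$ and $|\nabla\varphi(x_0)|\ge\gamma$, one has $\Delta\varphi(x_0)\le0$. No requirement is imposed at contact points where $|\nabla\varphi(x_0)|<\gamma$. The interior normal derivative is $\partial_\nu u(\xi)=\lim_{t\to0^+}\frac{u(\xi+t\nu)-u(\xi)}{t}$ with $\nu=-\xi$. *)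

(* Defs.v *)
From HB Require Import structures.
From mathcomp Require Import all_boot all_order all_algebra.
From mathcomp Require Import all_classical all_reals all_analysis.

Set Implicit Arguments.
Unset Strict Implicit.
Unset Printing Implicit Defensive.

Import Order.TTheory GRing.Theory Num.Theory.
Import numFieldNormedType.Exports.

Local Open Scope classical_set_scope.
Local Open Scope ring_scope.

(* The library's norm `|x| on row vectors is the sup norm, hence this one.
   Both induce the same topology, so the library's limits, continuity and
   directional derivatives are the usual ones of R^n. *)
Definition enorm (R : realType) (n : nat) (x : 'rV[R]_n) : R :=
  Num.sqrt (\sum_(i < n) x 0 i ^+ 2).

Definition unit_ball (R : realType) (n : nat) : set 'rV[R]_n :=
  [set x | enorm x < 1].

Definition closed_unit_ball (R : realType) (n : nat) : set 'rV[R]_n :=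
  [set x | enorm x <= 1].

Definition unit_sphere (R : realType) (n : nat) : set 'rV[R]_n :=
  [set x | enorm x = 1].

Definition partial (R : realType) (n : nat) (i : 'I_n) (f : 'rV[R]_n -> R) :
    'rV[R]_n -> R :=
  fun x => 'D_(delta_mx 0 i) f x.

Definition gradient (R : realType) (n : nat) (f : 'rV[R]_n -> R)
    (x : 'rV[R]_n) : 'rV[R]_n :=
  \row_(i < n) partial i f x.

Definition laplacian (R : realType) (n : nat) (f : 'rV[R]_n -> R)
    (x : 'rV[R]_n) : R :=
  \sum_(i < n) partial i (partial i f) x.

(* f is of class C^k on U, for U open: f is total, but only its restriction
   to U matters, because continuity and derivatives at a point are local. *)
Fixpoint Ck (R : realType) (n : nat) (k : nat) (U : set 'rV[R]_n)
    (f : 'rV[R]_n -> R) {struct k} : Prop :=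
  (forall x, U x -> {for x, continuous f}) /\
  (if k is k'.+1 then
     forall i : 'I_n,
       (forall x, U x -> derivable f x (delta_mx 0 i)) /\ Ck k' U (partial i f)
   else True).

Definition Cinfty (R : realType) (n : nat) (U : set 'rV[R]_n)
    (f : 'rV[R]_n -> R) : Prop :=
  forall k : nat, Ck k U f.

Definition local_min_at (R : realType) (n : nat) (f : 'rV[R]_n -> R)
    (x0 : 'rV[R]_n) : Prop :=
  \forall y \near x0, f x0 <= f y.

(* Laplacian(u) <= 0 in {x in B_1 : |grad u(x)| >= gamma} in the viscosity
   sense; contact points where |grad phi(x0)| < gamma are not tested. *)
Definition viscosity_super_large_gradient (R : realType) (n : nat) (gamma : R)
    (u : 'rV[R]_n -> R) : Prop :=
  forall (x0 : 'rV[R]_n) (phi : 'rV[R]_n -> R),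
    unit_ball x0 ->
    Ck 2 (@unit_ball R n) phi ->
    local_min_at (fun x => u x - phi x) x0 ->
    gamma <= enorm (gradient phi x0) ->
    laplacian phi x0 <= 0.

(* The inner unit normal to the unit sphere at xi is - xi. *)
Definition is_inner_normal_derivative (R : realType) (n : nat)
    (u : 'rV[R]_n -> R) (xi : 'rV[R]_n) (l : R) : Prop :=
  (u (xi + t *: (- xi)) - u xi) / t @[t --> (0 : R)^'+] --> l.

(* The existence of the normal derivative is a hypothesis here, so that the
   negation of hopf_conclusion exhibits a nonpositive normal derivative. *)
Definition hopf_conclusion (R : realType) (n : nat)
    (v : 'rV[R]_n -> R) (xi : 'rV[R]_n) : Prop :=
  v xi = 0 -> forall l : R, is_inner_normal_derivative v xi l -> 0 < l.

Definition hopf_lemma_large_gradient (R : realType) (n : nat) (gamma : R) :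
    Prop :=
  forall v : 'rV[R]_n -> R,
    {within @closed_unit_ball R n, continuous v} ->
    (forall x, unit_ball x -> 0 < v x) ->
    viscosity_super_large_gradient gamma v ->
    forall xi, unit_sphere xi -> hopf_conclusion v xi.

(* Defined on all of R^n, but only its values on the closed unit ball are
   ever used. *)
Definition hopf_cex (R : realType) (n : nat) (x : 'rV[R]_n) : R :=
  (1 - enorm x) ^+ 2.

(* Main.v *)
(* Away from the origin u = (1 - r)^2 is smooth with |grad u| = 2 (1 - r) and
   Laplacian 2 (n - (n - 1) / r).  A test function touching u from below at
   x0 <> 0 has the same gradient there and a Laplacian no larger than that of u;
   |grad u| >= 1 forces r <= 1/2, so the Laplacian of u is at most
   2 (2 - n) <= 0.  At the origin u has a concave conical vertex, which no
   differentiable function touches from below. *)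
Require Import Defs.
From HB Require Import structures.
From mathcomp Require Import all_boot all_order all_algebra.
From mathcomp Require Import all_classical all_reals all_analysis.
From mathcomp Require Import ring lra.

Import Order.TTheory GRing.Theory Num.Theory.
Import numFieldNormedType.Exports.

Local Open Scope classical_set_scope.
Local Open Scope ring_scope.

(** * Restriction of directional derivatives to lines *)

(** The two difference quotients agree as functions of [h], so derivability and the value of the
    derivative both transfer by a single rewrite. *)
Lemma growth_rate_line (R : realType) (V W : normedModType R) (f : V -> W)
    (x v : V) (t : R) :
  (fun h : R => h^-1 *: ((f \o shift (x + t *: v)) (h *: v) - f (x + t *: v))) =
  (fun h : R => h^-1 *: (((fun s : R => f (x + s *: v)) \o shift t) (h *: 1) -
                         f (x + t *: v))).
Proof.
apply/funext => h /=; congr (_ *: (f _ - _)).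
by rewrite [h *: 1]mulr1 scalerDl addrCA.
Qed.

Lemma derivable_line (R : realType) (V W : normedModType R) (f : V -> W)
    (x v : V) (t : R) :
  derivable f (x + t *: v) v <-> derivable (fun s : R => f (x + s *: v)) t 1.
Proof. by rewrite /derivable growth_rate_line. Qed.

Lemma derive_line (R : realType) (V W : normedModType R) (f : V -> W)
    (x v : V) (t : R) :
  'D_v f (x + t *: v) = 'D_1 (fun s : R => f (x + s *: v)) t.
Proof. by rewrite /derive growth_rate_line. Qed.

Lemma is_derive_line (R : realType) (V W : normedModType R) (f : V -> W)
    (x v : V) (df : W) :
  is_derive x v f df <-> is_derive (0 : R) 1 (fun s : R => f (x + s *: v)) df.
Proof.
have x0 : x = x + (0 : R) *: v by rewrite scale0r addr0.
split=> -[fd fE].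
  by rewrite x0 in fd fE; split; [exact/derivable_line|rewrite -derive_line].
by rewrite x0; split; [exact/derivable_line|rewrite derive_line].
Qed.

(** Along the line through [x] directed by [v], this is the one-variable chain rule. *)
Lemma is_derive_comp1 (R : realType) (V : normedModType R) (f : R -> R)
    (g : V -> R) (x v : V) (a b : R) :
  is_derive (g x) 1 f a -> is_derive x v g b -> is_derive x v (f \o g) (a * b).
Proof.
move=> fa /is_derive_line gb; apply/is_derive_line.
apply: (@is_derive1_comp _ f (fun s : R => g (x + s *: v))) => //.
by rewrite scale0r addr0.
Qed.

(** * Second-order conditions at a local minimum *)

(** The first claim is Fermat's rule. If the second derivative at 0 were negative, the first
    derivative, which vanishes at 0, would be negative just to the right of 0; then [g] would
    strictly decrease there, against minimality. *)
Lemma local_min_derive1 (R : realType) (g : R -> R) :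
    (\forall t \near 0, g 0 <= g t) ->
    (\forall t \near 0, derivable g t 1) -> derivable ('D_1 g) 0 1 ->
  'D_1 g 0 = 0 /\ 0 <= 'D_1 ('D_1 g) 0.
Proof.
move=> gmin gd ggd.
have [e /= e0 He] : \forall t \near (0 : R), g 0 <= g t /\ derivable g t 1.
  by exact: filterI gmin gd.
have {}He t : -e < t < e -> g 0 <= g t /\ derivable g t 1.
  by move=> te; apply: He => /=; rewrite sub0r normrN ltr_norml.
have g0 : 'D_1 g 0 = 0.
  apply: derive_val; apply: (@derive1_at_min _ _ (- e) e).
  - by lra.
  - by move=> t /[!in_itv] te; have [] := He _ te.
  - by rewrite in_itv /=; lra.
  - by move=> t /[!in_itv] te; have [] := He _ te.
split => //; rewrite leNgt; apply/negP => neg.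
have [d /= d0 Hd] : \forall h \near (0 : R)^',
    h^-1 *: (('D_1 g \o shift 0) (h *: 1) - 'D_1 g 0) < 0.
  by move/cvgr_lt : ggd; apply.
have {}Hd t : 0 < t < d -> 'D_1 g t < 0.
  move=> /andP[t0 td]; have := Hd t; rewrite /= sub0r normrN gtr0_norm//.
  move=> /(_ td); rewrite gt_eqF// => /(_ isT).
  by rewrite g0 subr0 addr0 [t *: 1]mulr1 pmulr_rlt0 ?invr_gt0.
(* Halving keeps the closed interval from 0 to [m] inside both neighbourhoods: the one where [g] is
   derivable and at least [g 0], and the one where its derivative is negative. *)
pose m := Num.min d e / 2.
have m0 : 0 < m by rewrite divr_gt0// lt_min d0 e0.
have [md me] : m < d /\ m < e.
  have : m < Num.min d e by rewrite /m ltr_pdivrMr// mulr2n mulrDr mulr1 ltrDl lt_min d0.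
  by rewrite lt_min => /andP.
have /(_ m) [|] := He; first by lra.
rewrite leNgt => /negP + _; apply.
have gdm t : t \in `]0, m[ -> derivable g t 1.
  by rewrite in_itv /= => /andP[t0 tm]; have [|_ ?] := He t; first lra.
have gm t : t \in `]0, m[ -> (g^`())%classic t < 0.
  by rewrite in_itv /= => /andP[t0 tm]; rewrite derive1E; apply: Hd; lra.
have gc : {within `[0, m], continuous g}.
  apply: derivable_within_continuous => t.
  by rewrite in_itv /= => /andP[t0 tm]; have [|_ ?] := He t; first lra.
by apply: (ltr0_derive1_lt_cc gdm gm gc); rewrite ?in_itv /= ?lexx ?ltW.
Qed.

Lemma local_min_derive (R : realType) (V : normedModType R) (f : V -> R)
    (x v : V) :
    (\forall y \near x, f x <= f y) ->
    (\forall y \near x, derivable f y v) -> derivable ('D_v f) x v ->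
  'D_v f x = 0 /\ 0 <= 'D_v ('D_v f) x.
Proof.
have x0 : x = x + (0 : R) *: v by rewrite scale0r addr0.
have line : x + s *: v @[s --> (0 : R)] --> x.
  by rewrite {2}x0; apply: cvgD; [exact: cvg_cst|exact: cvgZr_tmp cvg_id].
move=> fmin fd ffd.
have [|||] := @local_min_derive1 R (fun s : R => f (x + s *: v)).
- by rewrite -x0; exact: line fmin.
- by near=> s; apply/derivable_line; near: s; exact: line fd.
- rewrite x0 in ffd; move/derivable_line: ffd.
  by under [X in derivable X]funext => s do rewrite derive_line.
- have E : 'D_1 (fun s : R => f (x + s *: v)) = fun s : R => 'D_v f (x + s *: v).
    by apply/funext => s; rewrite derive_line.
  rewrite E => -[g1 g2]; rewrite x0 (derive_line _ _ _ f) (derive_line _ _ _ ('D_v f)).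
  by split; [exact: g1|exact: g2].
Unshelve. all: by end_near. Qed.

(** * The Euclidean norm: algebra, continuity, derivatives *)

Lemma enorm_ge0 (R : realType) (n : nat) (x : 'rV[R]_n) : 0 <= enorm x.
Proof. exact: sqrtr_ge0. Qed.

Lemma sqr_enorm (R : realType) (n : nat) (x : 'rV[R]_n) :
  enorm x ^+ 2 = \sum_(i < n) x 0 i ^+ 2.
Proof. by rewrite sqr_sqrtr// sumr_ge0// => i _; exact: sqr_ge0. Qed.

Lemma enormZ (R : realType) (n : nat) (a : R) (x : 'rV[R]_n) :
  enorm (a *: x) = `|a| * enorm x.
Proof.
rewrite /enorm -sqrtr_sqr -sqrtrM ?sqr_ge0// mulr_sumr; congr Num.sqrt.
by apply: eq_bigr => i _; rewrite mxE exprMn.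
Qed.

Lemma enorm_eq0 (R : realType) (n : nat) (x : 'rV[R]_n) :
  (enorm x == 0) = (x == 0).
Proof.
apply/eqP/eqP => [x0|->]; last by rewrite -(scale0r 0) enormZ normr0 mul0r.
have /eqP : enorm x ^+ 2 = 0 by rewrite x0 expr0n.
rewrite sqr_enorm psumr_eq0 => [/allP x2|i _]; last exact: sqr_ge0.
apply/rowP => i; rewrite mxE; apply/eqP.
by rewrite -sqrf_eq0; apply: x2; rewrite mem_index_enum.
Qed.

Lemma enorm_delta (R : realType) (n : nat) (i : 'I_n) :
  enorm (delta_mx 0 i : 'rV[R]_n) = 1.
Proof.
rewrite /enorm (bigD1 i)//= big1 => [|j ji]; rewrite mxE eqxx/=.
  by rewrite eqxx expr1n addr0 sqrtr1.
by rewrite (negbTE ji) expr0n.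
Qed.

Lemma continuous_sqr_sum (R : realType) (n : nat) :
  continuous (fun x : 'rV[R]_n => \sum_(i < n) x 0 i ^+ 2).
Proof.
apply: (@continuous_big _ _ +%R) => [|i _ x]; first exact: add_continuous.
have xi : (fun y : 'rV[R]_n => y 0 i) @ x --> x 0 i by exact: coord_continuous.
exact: (cvgM xi xi).
Qed.

Lemma continuous_enorm (R : realType) (n : nat) :
  continuous (@enorm R n).
Proof.
move=> x; apply: continuous_comp; first exact: continuous_sqr_sum.
exact: sqrt_continuous.
Qed.

Lemma open_unit_ball (R : realType) (n : nat) : open (@unit_ball R n).
Proof.
apply: (@open_comp _ _ (@enorm R n) [set r | r < 1]) => [x _|].
  exact: continuous_enorm.
exact: open_lt.
Qed.

Lemma open_punctured_unit_ball (R : realType) (n : nat) :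
  open (@unit_ball R n `\ 0).
Proof.
have -> : @unit_ball R n `\ 0 = @unit_ball R n `&` [set x | 0 < enorm x].
  apply/seteqP; split => x [x1 x0]; split => //=.
    by rewrite lt_def enorm_ge0 enorm_eq0 andbT; exact/eqP.
  by move=> /eqP; rewrite -enorm_eq0 gt_eqF.
apply: openI; first exact: open_unit_ball.
apply: (@open_comp _ _ (@enorm R n) [set r | 0 < r]) => [x _|].
  exact: continuous_enorm.
exact: open_gt.
Qed.

(** Derivatives of matrix-valued maps are entrywise, so this is one entry of the derivative of the
    identity. *)
Lemma is_derive_coord (R : realType) (n : nat) (x v : 'rV[R]_n) (i : 'I_n) :
  is_derive x v (fun y : 'rV[R]_n => y 0 i) (v 0 i).
Proof.
have /derivable_mxP dx : derivable (id : 'rV[R]_n -> _) x v by exact: derivable_id.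
split; first exact: dx.
have := @derive_id _ _ x v; rewrite derive_mx; last exact: derivable_id.
by move/matrixP => /(_ 0 i); rewrite mxE.
Qed.

Lemma is_derive_enorm (R : realType) (n : nat) (x : 'rV[R]_n) (i : 'I_n) :
  x != 0 -> is_derive x (delta_mx 0 i) (@enorm R n) (x 0 i / enorm x).
Proof.
move=> x0; have r0 : 0 < enorm x by rewrite lt_def enorm_eq0 x0 enorm_ge0.
have sum_gt0 : 0 < \sum_(j < n) x 0 j ^+ 2 by rewrite -sqr_enorm exprn_gt0.
(* The sum of squares is recast as a sum of functions, the form that [is_derive_sum] differentiates;
   [fct_sumE] converts back. *)
pose h (j : 'I_n) (y : 'rV[R]_n) : R := y 0 j ^+ 2.
have dN : is_derive x (delta_mx 0 i) (\sum_(j < n) h j) (2 * x 0 i).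
  have := @is_derive_sum _ _ _ n h x (delta_mx 0 i)
    (fun j => (2 * x 0 j) *: (delta_mx 0 i : 'rV[R]_n) 0 j).
  move=> dsum; apply: is_derive_eq.
    apply: dsum => j; have := is_deriveX 2 (is_derive_coord R n x (delta_mx 0 i) j).
    by rewrite expr1.
  rewrite (bigD1 i)//= big1 => [|j ji]; rewrite mxE eqxx/=.
    by rewrite eqxx addr0 [_ *: _]mulr1.
  by rewrite (negbTE ji) scaler0.
have -> : is_derive x (delta_mx 0 i) (@enorm R n) =
          is_derive x (delta_mx 0 i) (Num.sqrt \o (\sum_(j < n) h j)).
  by congr is_derive; apply/funext => y; rewrite /enorm /= fct_sumE.
apply: is_derive_eq.
  apply: is_derive_comp1 dN; apply: is_derive1_sqrt.
  by rewrite fct_sumE.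
by rewrite fct_sumE -[Num.sqrt _]/(enorm x); field; rewrite gt_eqF.
Qed.

Lemma is_derive_enormV (R : realType) (n : nat) (x : 'rV[R]_n) (i : 'I_n) :
  x != 0 -> is_derive x (delta_mx 0 i) (fun y : 'rV[R]_n => (enorm y)^-1)
                        (- (x 0 i * (enorm x)^-1 ^+ 3)).
Proof.
move=> x0; have r0 : enorm x != 0 by rewrite enorm_eq0.
have dV := is_deriveV (f := id) r0 (is_derive_id (enorm x) 1).
have := is_derive_comp1 _ _ _ _ _ _ _ _ dV (is_derive_enorm _ _ _ i x0).
move/is_derive_eq; apply.
by rewrite [_ *: _]mulr1; field.
Qed.

(** * Smoothness away from the origin *)

Lemma Ck_subset (R : realType) (n k : nat) (U V : set 'rV[R]_n)
    (f : 'rV[R]_n -> R) :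
  V `<=` U -> Ck k U f -> Ck k V f.
Proof.
move=> VU; elim: k f => [|k IHk] f [cf df].
  by split=> // x /VU /cf.
split=> [x /VU /cf//|i]; have [dfi Ckf] := df i.
by split=> [x /VU /dfi//|]; exact: IHk.
Qed.

(* Closed under the partial derivatives off the origin, so that its members are
   of class C^k there for every k. *)
Inductive radial_algebra (R : realType) (n : nat) : ('rV[R]_n -> R) -> Prop :=
| radial_cst c : radial_algebra R n (fun=> c)
| radial_coord i : radial_algebra R n (fun x => x 0 i)
| radial_enorm : radial_algebra R n (@enorm R n)
| radial_enormV : radial_algebra R n (fun x => (enorm x)^-1)
| radial_add f g : radial_algebra R n f -> radial_algebra R n g ->
    radial_algebra R n (fun x => f x + g x)
| radial_mul f g : radial_algebra R n f -> radial_algebra R n g ->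
    radial_algebra R n (fun x => f x * g x).

Lemma radial_algebra_continuous (R : realType) (n : nat) (f : 'rV[R]_n -> R)
    (x : 'rV[R]_n) :
  radial_algebra R n f -> x != 0 -> {for x, continuous f}.
Proof.
move=> + x0; elim=> [c|i|||{}f g _ cf _ cg|{}f g _ cf _ cg].
- exact: cst_continuous.
- exact: (@coord_continuous _ _ _ 0 i x).
- exact: continuous_enorm.
- have r0 : enorm x != 0 by rewrite enorm_eq0.
  exact: (cvgV r0 (@continuous_enorm R n x)).
- exact: (cvgD cf cg).
- exact: (cvgM cf cg).
Qed.

Lemma radial_algebra_derive (R : realType) (n : nat) (f : 'rV[R]_n -> R)
    (i : 'I_n) :
  radial_algebra R n f -> exists2 g, radial_algebra R n g &
    forall x, x != 0 -> is_derive x (delta_mx 0 i) f (g x).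
Proof.
elim=> [c|j|||{}f g rf [f' rf' df] rg [g' rg' dg]|{}f g rf [f' rf' df] rg [g' rg' dg]].
- by exists (fun=> 0); [exact: radial_cst|move=> x _; exact: is_derive_cst].
- exists (fun=> (delta_mx 0 i : 'rV[R]_n) 0 j); first exact: radial_cst.
  by move=> x _; exact: is_derive_coord.
- exists (fun x : 'rV[R]_n => x 0 i * (enorm x)^-1).
    by apply: radial_mul; [exact: radial_coord|exact: radial_enormV].
  by move=> x; exact: is_derive_enorm.
- exists (fun x : 'rV[R]_n => (-1) * (x 0 i * ((enorm x)^-1 * ((enorm x)^-1 * (enorm x)^-1)))).
    apply: radial_mul; first exact: radial_cst.
    apply: radial_mul; first exact: radial_coord.
    do 2?[apply: radial_mul; first exact: radial_enormV].
    exact: radial_enormV.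
  move=> x /is_derive_enormV => /(_ i) /is_derive_eq; apply.
  by rewrite mulN1r !exprS expr0 mulr1.
- exists (fun x => f' x + g' x); first exact: radial_add.
  by move=> x x0; exact: (is_deriveD (df x x0) (dg x x0)).
- exists (fun x => f x * g' x + g x * f' x).
    by apply: radial_add; exact: radial_mul.
  by move=> x x0; exact: (is_deriveM (df x x0) (dg x x0)).
Qed.

(** Induction on [k]. The function [g] is only asked to agree with a member of the algebra on [U],
    because its partial derivatives are identified with members of the algebra on [U] alone; this is
    what the induction hypothesis must accept. *)
Lemma radial_algebra_Ck (R : realType) (n k : nat) (U : set 'rV[R]_n)
    (f g : 'rV[R]_n -> R) :
    open U -> (forall x, U x -> x != 0) -> radial_algebra R n f ->
  (forall x, U x -> g x = f x) -> Ck k U g.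
Proof.
move=> oU U0; elim: k f g => [|k IHk] f g rf gf;
    have near_fg x : U x -> \forall y \near x, f y = g y by
      (move=> Ux; near=> y; rewrite gf//; near: y; exact: open_nbhs_nbhs).
all: have cg x : U x -> {for x, continuous g} by
  (move=> Ux; apply: (cvg_trans (near_eq_cvg (near_fg x Ux)));
   rewrite gf//; apply: radial_algebra_continuous => //; exact: U0).
  by [].
split=> // i; have [f' rf' df] := radial_algebra_derive _ _ _ i rf.
have dg x : U x -> is_derive x (delta_mx 0 i) g (f' x).
  by move=> Ux; apply: near_eq_is_derive (near_fg x Ux) (df x (U0 x Ux)).
split=> [x /dg[]//|]; apply: (IHk f') => // x /dg dgx.
exact: derive_val.
Unshelve. all: by end_near. Qed.

Lemma hopf_cex_Ck (R : realType) (n k : nat) :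
  Ck k (@unit_ball R n `\ 0) (@hopf_cex R n).
Proof.
(* The generators offer only constants, sums and products, hence the factor -1 in place of a
   subtraction and a product in place of a square. *)
apply: (@radial_algebra_Ck _ _ _ _
  (fun x => (1 + (-1) * enorm x) * (1 + (-1) * enorm x))).
- exact: open_punctured_unit_ball.
- by move=> x [_ /eqP].
- have r1 : radial_algebra R n (fun x => 1 + (-1) * enorm x).
    apply: radial_add; first exact: radial_cst.
    by apply: radial_mul; [exact: radial_cst|exact: radial_enorm].
  exact: radial_mul.
- by move=> x _; rewrite /hopf_cex mulN1r expr2.
Qed.

(** * Gradient and Laplacian of the counterexample *)

Lemma is_derive_hopf_cex (R : realType) (n : nat) (x : 'rV[R]_n) (i : 'I_n) :
  x != 0 -> is_derive x (delta_mx 0 i) (@hopf_cex R n)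
                      (2 * (x 0 i * (1 - (enorm x)^-1))).
Proof.
move=> x0; have dr := is_derive_enorm _ _ _ i x0.
have /is_derive_eq := is_deriveX 2 (is_deriveB (is_derive_cst (1 : R) x _) dr).
apply; rewrite sub0r expr1.
transitivity (2 * (1 - enorm x) * - (x 0 i / enorm x)); first by [].
by field; rewrite enorm_eq0.
Qed.

Lemma partial2_hopf_cex (R : realType) (n : nat) (x : 'rV[R]_n) (i : 'I_n) :
  x != 0 -> partial i (partial i (@hopf_cex R n)) x =
            2 * (1 - (enorm x)^-1 + x 0 i ^+ 2 * (enorm x)^-1 ^+ 3).
Proof.
move=> x0; have dw := is_derive_enormV _ _ _ i x0.
have dx := is_derive_coord _ _ x (delta_mx 0 i) i.
have dxw := is_deriveZ 2 (is_deriveM dx (is_deriveB (is_derive_cst (1 : R) x _) dw)).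
have nx : \forall y \near x, y != 0 by exact: (@cvgr_neq0 _ _ _ _ _ id _ cvg_id x0).
(* The formula for the first partial derivative holds only off the origin, but it holds throughout a
   neighbourhood of [x], which suffices to differentiate it again at [x]. *)
transitivity ('D_(delta_mx 0 i)
    (fun y : 'rV[R]_n => 2 * (y 0 i * (1 - (enorm y)^-1))) x).
  apply: near_eq_derive; near=> y.
  apply: derive_val; apply: is_derive_hopf_cex.
  by near: y; exact: nx.
apply: derive_val; move/is_derive_eq: dxw; apply.
rewrite !mxE !eqxx/=.
transitivity (2 * (x 0 i * (0 - - (x 0 i * (enorm x)^-1 ^+ 3)) +
                   (1 - (enorm x)^-1) * 1)); first by [].
by ring.
Unshelve. all: by end_near. Qed.

Lemma partial_hopf_cex (R : realType) (n : nat) (x : 'rV[R]_n) (i : 'I_n) :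
  x != 0 -> partial i (@hopf_cex R n) x = 2 * (x 0 i * (1 - (enorm x)^-1)).
Proof. by move=> x0; apply: derive_val; exact: is_derive_hopf_cex. Qed.

Lemma laplacian_hopf_cex (R : realType) (n : nat) (x : 'rV[R]_n) :
  x != 0 -> laplacian (@hopf_cex R n) x =
            2 * (n%:R - (n%:R - 1) * (enorm x)^-1).
Proof.
move=> x0; have r0 : enorm x != 0 by rewrite enorm_eq0.
rewrite /laplacian.
under eq_bigr do rewrite (partial2_hopf_cex _ _ _ _ x0).
(* With r the norm of [x], the squares of the coordinates add up to r^2, so the last terms of the
   second partial derivatives contribute 1/r in total. *)
rewrite -mulr_sumr big_split/= -mulr_suml -sqr_enorm sumr_const card_ord.
by rewrite -[_ *+ n]mulr_natr; field.
Qed.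

Lemma enorm_gradient_hopf_cex (R : realType) (n : nat) (x : 'rV[R]_n) :
  x != 0 -> enorm (gradient (@hopf_cex R n) x) = 2 * `|1 - enorm x|.
Proof.
move=> x0; have r0 : enorm x != 0 by rewrite enorm_eq0.
have -> : gradient (@hopf_cex R n) x = (2 * (1 - (enorm x)^-1)) *: x.
  apply/rowP => i; rewrite !mxE partial_hopf_cex//; ring.
rewrite enormZ -{2}(ger0_norm (enorm_ge0 _ _ x)) -normrM distrC.
rewrite -(gtr0_norm (_ : 0 < 2 :> R))// -normrM; congr `|_|.
by rewrite gtr0_norm//; field.
Qed.

(** * Test functions touching from below *)

(** These are the second-order conditions for [f - g] along each coordinate axis. Pure second
    derivatives are enough, since the Laplacian is their sum. *)
Lemma local_min_sub_partial (R : realType) (n : nat) (U : set 'rV[R]_n)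
    (f g : 'rV[R]_n -> R) (x : 'rV[R]_n) (i : 'I_n) :
    open U -> U x -> Ck 2 U f -> Ck 2 U g ->
    local_min_at (fun y => f y - g y) x ->
  partial i g x = partial i f x /\
  partial i (partial i g) x <= partial i (partial i f) x.
Proof.
move=> oU Ux [_ /(_ i)[df [_ /(_ i)[ddf _]]]] [_ /(_ i)[dg [_ /(_ i)[ddg _]]]] fgmin.
have dfg y : U y -> is_derive y (delta_mx 0 i) (fun y => f y - g y)
                              (partial i f y - partial i g y).
  by move=> Uy; exact: (is_deriveB (derivableP (df y Uy)) (derivableP (dg y Uy))).
have ddfg : is_derive x (delta_mx 0 i) ('D_(delta_mx 0 i) (fun y => f y - g y))
                      (partial i (partial i f) x - partial i (partial i g) x).
  apply: near_eq_is_derive (is_deriveB (derivableP (ddf x Ux)) (derivableP (ddg x Ux))).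
  near=> y; rewrite (@derive_val _ _ _ _ _ _ _ (dfg y _))//.
  by near: y; exact: open_nbhs_nbhs.
have [||] := local_min_derive _ _ _ x (delta_mx 0 i) fgmin.
- near=> y; have [|//] := dfg y.
  by near: y; exact: open_nbhs_nbhs.
- by case: ddfg.
rewrite (@derive_val _ _ _ _ _ _ _ (dfg x Ux)) (@derive_val _ _ _ _ _ _ _ ddfg).
by move=> /eqP; rewrite subr_eq0 subr_ge0 => /eqP ->.
Unshelve. all: by end_near. Qed.

(* Touching u from below at the vertex forces the slope of phi to be at most -2
   both in the direction delta_mx 0 i and in the opposite one. *)
Lemma hopf_cex_no_test_at0 (R : realType) (n : nat) (phi : 'rV[R]_n -> R)
    (i : 'I_n) :
  derivable phi 0 (delta_mx 0 i) ->
  ~ local_min_at (fun y => @hopf_cex R n y - phi y) 0.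
Proof.
move=> dphi phimin; pose e : 'rV[R]_n := delta_mx 0 i.
have line : (s : R) *: e @[s --> (0 : R)] --> (0 : 'rV[R]_n).
  by rewrite -[X in _ --> X](scale0r e); exact: cvgZr_tmp cvg_id.
have [r /= r0 Hr] : \forall s \near (0 : R),
    hopf_cex (0 : 'rV[R]_n) - phi 0 <= hopf_cex (s *: e) - phi (s *: e).
  exact: line phimin.
have [d /= d0 Hd] : \forall s \near (0 : R)^',
    `|'D_e phi 0 - s^-1 *: ((phi \o shift 0) (s *: e) - phi 0)| < 1.
  by move/cvgrPdist_lt : dphi; apply.
(* Besides lying in both neighbourhoods, [s] must be below 1: this is the bound contradicted at the
   end. *)
have [s [s0 sd sr s1]] : exists s : R, [/\ 0 < s, s < d, s < r & s < 1].
  exists (Num.min d (Num.min r 1) / 2).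
  have m0 : 0 < Num.min d (Num.min r 1) by rewrite !lt_min d0 r0 ltr01.
  have : Num.min d (Num.min r 1) / 2 < Num.min d (Num.min r 1) by lra.
  by rewrite !lt_min => /and3P[-> -> ->]; rewrite divr_gt0.
have cexE (t : R) : hopf_cex (t *: e) = (1 - `|t|) ^+ 2.
  by rewrite /hopf_cex enormZ enorm_delta mulr1.
have cex0 : hopf_cex (0 : 'rV[R]_n) = 1.
  by rewrite -(scale0r e) cexE normr0 subr0 expr1n.
have upper t : `|t| < r -> phi (t *: e) - phi 0 <= (1 - `|t|) ^+ 2 - 1.
  move=> tr; have : hopf_cex (0 : 'rV[R]_n) - phi 0 <=
                    hopf_cex (t *: e) - phi (t *: e).
    by apply: Hr; rewrite /= sub0r normrN.
  by rewrite cexE cex0; lra.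
(* The difference quotient is within 1 of the derivative, so the increment of [phi] differs from its
   linear part by less than |t|. *)
have lower t : t != 0 -> `|t| < d ->
    'D_e phi 0 * t - (phi (t *: e) - phi 0) < `|t|.
  move=> t0 td; have -> : 'D_e phi 0 * t - (phi (t *: e) - phi 0) =
      t * ('D_e phi 0 - t^-1 * (phi (t *: e) - phi 0)) by field.
  apply: le_lt_trans (ler_norm _) _; rewrite normrM gtr_pMr ?normr_gt0//.
  by have := Hd t; rewrite /= sub0r normrN addr0; apply.
have ns : `|s| = s by rewrite gtr0_norm.
have := upper s; rewrite ns => /(_ sr).
have := upper (- s); rewrite normrN ns => /(_ sr).
have := lower s; rewrite ns gt_eqF// => /(_ isT sd).
have := lower (- s); rewrite normrN ns oppr_eq0 gt_eqF// => /(_ isT sd).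
(* Adding the bounds at [s] and [- s] cancels the linear term: the sum of the two increments exceeds
   -2s by [lower] and is at most 2s^2 - 4s by [upper]. Hence s > 1, a contradiction. *)
by move: (phi 0) (phi _) (phi _) ('D_e phi 0) => p0 p1 p2 a; nra.
Qed.

Lemma hopf_cex_viscosity (R : realType) (n : nat) :
  (2 <= n)%N -> viscosity_super_large_gradient 1 (@hopf_cex R n).
Proof.
move=> n2 x phi x1 phiC2 phimin gphi.
have [x0|x0] := eqVneq x 0.
  (* Any coordinate direction would do at the vertex; the first one exists since n is positive. *)
  have [_ /(_ (Ordinal (ltnW n2)))[dphi _]] := phiC2.
  have := @hopf_cex_no_test_at0 R n phi (Ordinal (ltnW n2)).
  by rewrite -x0 => /(_ (dphi x x1) phimin).
have Ux : (@unit_ball R n `\ 0) x by split=> //; exact/eqP.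
have comp i := local_min_sub_partial _ _ _ _ _ x i (@open_punctured_unit_ball R n) Ux
  (hopf_cex_Ck R n 2) (Ck_subset _ _ _ _ _ _ (@subDsetl _ _ _) phiC2) phimin.
have gradE : gradient phi x = gradient (@hopf_cex R n) x.
  by apply/rowP => i; rewrite !mxE; have [] := comp i.
move: gphi; rewrite gradE enorm_gradient_hopf_cex// ger0_norm; last first.
  by rewrite subr_ge0 ltW.
move=> r2; have r0 : 0 < enorm x by rewrite lt_def enorm_eq0 x0 enorm_ge0.
apply: (@le_trans _ _ (laplacian (@hopf_cex R n) x)).
  by apply: ler_sum => i _; have [] := comp i.
rewrite laplacian_hopf_cex//.
(* The gradient bound reads 1 <= 2(1 - r), so 1/r >= 2; then n - (n - 1)/r <= n - 2(n - 1) = 2 - n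
   <= 0. *)
have w2 : 2 <= (enorm x)^-1 by rewrite -[2]invrK lef_pV2 ?posrE//; lra.
have : 2 <= n%:R :> R by rewrite ler_nat.
nra.
Qed.

(** * Boundary behaviour and failure of Hopf's conclusion *)

Lemma hopf_cex_sphere (R : realType) (n : nat) (x : 'rV[R]_n) :
  unit_sphere x -> hopf_cex x = 0.
Proof. by rewrite /hopf_cex => ->; rewrite subrr expr0n. Qed.

(** On the segment from [xi] to the centre the norm is 1 - t for 0 < t < 1, so the function equals
    t^2 and its difference quotient is t. *)
Lemma hopf_cex_normal_derivative (R : realType) (n : nat) (xi : 'rV[R]_n) :
  unit_sphere xi -> is_inner_normal_derivative (@hopf_cex R n) xi 0.
Proof.
move=> xi1; rewrite /is_inner_normal_derivative hopf_cex_sphere//.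
have id0 : (t : R) @[t --> (0 : R)^'+] --> (0 : R).
  exact: cvg_at_right_filter cvg_id.
apply: cvg_trans id0; apply: near_eq_cvg; near=> t.
have t0 : 0 < t by near: t; exact: nbhs_right_gt.
have t1 : t < 1 by near: t; exact: nbhs_right_lt.
have -> : xi + t *: - xi = (1 - t) *: xi by rewrite scalerBl scale1r scalerN.
rewrite /hopf_cex enormZ xi1 mulr1 gtr0_norm ?subr_gt0//.
by rewrite subr0 subKr expr2 mulfK// gt_eqF.
Unshelve. all: by end_near. Qed.

Theorem proposition2p2 (R : realType) (n : nat) (hn : (2 <= n)%N) :
  let u := @hopf_cex R n in
  {within @closed_unit_ball R n, continuous u} /\
  Cinfty (@unit_ball R n `\ 0) u /\
  (forall x, unit_ball x -> 0 <= u x) /\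
  (forall x, unit_sphere x -> u x = 0) /\
  viscosity_super_large_gradient 1 u /\
  (forall xi, unit_sphere xi -> is_inner_normal_derivative u xi 0) /\
  (forall xi, unit_sphere xi -> ~ hopf_conclusion u xi) /\
  ~ hopf_lemma_large_gradient n (1 : R).
Proof.
move=> u.
have uc : {within @closed_unit_ball R n, continuous u}.
  apply: continuous_subspaceT => x.
  have r1 : (fun y : 'rV[R]_n => 1 - enorm y) @ x --> 1 - enorm x.
    exact: (cvgB (@cst_continuous _ _ (1 : R) x) (@continuous_enorm R n x)).
  exact: (cvgM r1 r1).
have nohopf xi : unit_sphere xi -> ~ hopf_conclusion u xi.
  (* Instantiated at the actual normal derivative 0, the conclusion would give 0 < 0. *)
  move=> xi1 /(_ (hopf_cex_sphere _ _ _ xi1) 0).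
  by rewrite ltxx => /(_ (hopf_cex_normal_derivative _ _ _ xi1)).
split => //; split; first by move=> k; exact: hopf_cex_Ck.
split; first by move=> x _; exact: sqr_ge0.
split; first exact: hopf_cex_sphere.
split; first exact: hopf_cex_viscosity.
split; first exact: hopf_cex_normal_derivative.
split => // hopf.
(* Refuting the general lemma takes one boundary point: the first basis vector. The function is
   strictly positive in the open ball, as the lemma requires. *)
have e1 := enorm_delta R n (Ordinal (ltnW hn)).
apply: (nohopf _ e1); apply: hopf => //; last exact: hopf_cex_viscosity.
by move=> x x1; rewrite exprn_gt0// subr_gt0.
Qed.
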